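(* The maximal function inequality $$\|U(t)f\|_{L^p_xL^\infty_t}\le C\|f\|_{\hat H^{s,\frac p2}(\mathbb{R})}$$ does not hold if $s<\frac1p$.
   Context: The setting is one space dimension, and $C$ denotes a constant independent of $f$. The Fourier transform on $\mathbb{R}$ is $\hat f(\xi)=(2\pi)^{-1/2}\int_{\mathbb{R}}e^{-ix\xi}f(x)\,dx$, and $\mathscr{S}'(\mathbb{R})$ denotes the tempered distributions. With $r'$ given by $\frac1r+\frac1{r'}=1$, the Fourier-Lebesgue space is $$\hat H^{s,r}(\mathbb{R})=\{f\in\mathscr{S}'(\mathbb{R}):\ \|f\|_{\hat H^{s,r}(\mathbb{R})}=\|\langle\xi\rangle^s\hat f\|_{L^{r'}_\xi(\mathbb{R})}<\infty\},\qquad \langle\xi\rangle^s=(1+|\xi|^2)^{s/2};$$ in the inequality it is used with $r=\frac p2$. The Schr\''odinger propagator is $U(t)f(x)=(2\pi)^{-1/2}\int_{\mathbb{R}}e^{ix\xi-it|\xi|^2}\hat f(\xi)\,d\xi$. The mixed norm is $\|F\|_{L^p_xL^\infty_t}=\big(\int_{\mathbb{R}}\|F(x,\cdot)\|_{L^\infty_t(\mathbb{R})}^p\,dx\big)^{1/p}$. *)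

(* Defs.v *)
From mathcomp Require Import all_boot all_order all_algebra.
From mathcomp Require Import all_classical all_reals all_analysis.
Import Order.TTheory GRing.Theory Num.Theory.
Import numFieldNormedType.Exports.
From mathcomp Require Import complex.

Set Implicit Arguments.
Unset Strict Implicit.
Unset Printing Implicit Defensive.

Local Open Scope classical_set_scope.
Local Open Scope ring_scope.
Local Open Scope complex_scope.

Section ComplexValued.
Context {R : realType}.
Implicit Types (g phi psi : R -> R[i]).

Definition cexpi (theta : R) : R[i] := cos theta +i* sin theta.

Definition cmod (z : R[i]) : R := ComplexField.Normc.normc z.

Definition cmeasurable g : Prop :=
  measurable_fun [set: R] (fun x => Re (g x)) /\
  measurable_fun [set: R] (fun x => Im (g x)).

Definition cintegrable g : Prop :=
  (@lebesgue_measure R).-integrable [set: R] (fun x => (Re (g x))%:E) /\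
  (@lebesgue_measure R).-integrable [set: R] (fun x => (Im (g x))%:E).

Definition cintegral g : R[i] :=
  (\int[@lebesgue_measure R]_x Re (g x)) +i*
  (\int[@lebesgue_measure R]_x Im (g x)).

Definition cderiv (k : nat) g (x : R) : R[i] :=
  derive1n k (fun y => Re (g y)) x +i* derive1n k (fun y => Im (g y)) x.

Definition smooth (u : R -> R) : Prop :=
  forall (k : nat) (x : R), derivable (derive1n k u) x 1.

Definition schwartz phi : Prop :=
  [/\ smooth (fun x => Re (phi x)), smooth (fun x => Im (phi x)) &
      forall j k : nat, exists M : R, forall x : R,
        `|x| ^+ j * cmod (cderiv k phi x) <= M].

Definition schwartz_seminorm (j k : nat) phi : R :=
  sup (range (fun x : R => `|x| ^+ j * cmod (cderiv k phi x))).

(* Functionals are total on [R -> R[i]], but only their values at Schwartz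
   functions are ever constrained or used. *)
Definition tempered (T : (R -> R[i]) -> R[i]) : Prop :=
  (forall (a : R[i]) phi psi, schwartz phi -> schwartz psi ->
     T (fun x => a * phi x + psi x) = a * T phi + T psi) /\
  (exists (C : R) (N : nat), forall phi, schwartz phi ->
     cmod (T phi) <=
       C * \sum_(j < N.+1) \sum_(k < N.+1) schwartz_seminorm j k phi).

Definition fourier phi (xi : R) : R[i] :=
  ((Num.sqrt (2 * pi))^-1)%:C * cintegral (fun x => cexpi (- (x * xi)) * phi x).

(* The Fourier transform of [T], i.e. the distribution [phi |-> T (fourier phi)],
   is (integration against) the measurable function [That]. *)
Definition is_fourier_of (T : (R -> R[i]) -> R[i]) (That : R -> R[i]) : Prop :=
  cmeasurable That /\
  forall phi, schwartz phi ->
    cintegrable (fun xi => That xi * phi xi) /\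
    T (fourier phi) = cintegral (fun xi => That xi * phi xi).

Definition japanese (s xi : R) : R := (1 + `|xi| ^+ 2) `^ (s / 2).

(* The norm of H^{s,r} depends on a distribution only through its Fourier
   transform [fhat], and does not depend on the representative of [fhat]. *)
Definition FL_norm (s : R) (r : \bar R) (fhat : R -> R[i]) : \bar R :=
  Lnorm (@lebesgue_measure R) (hoelder_conjugate r)
    (fun xi => (japanese s xi * cmod (fhat xi))%:E).

(* [f] belongs to H^{s,r}, with Fourier transform [fhat]. *)
Definition in_FL (s : R) (r : \bar R) (f : (R -> R[i]) -> R[i])
    (fhat : R -> R[i]) : Prop :=
  [/\ tempered f, is_fourier_of f fhat & (FL_norm s r fhat < +oo)%E].

Definition propagator (fhat : R -> R[i]) (t x : R) : R[i] :=
  ((Num.sqrt (2 * pi))^-1)%:C *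
  cintegral (fun xi => cexpi (x * xi - t * `|xi| ^+ 2) * fhat xi).

Definition mixed_norm (p : R) (F : R -> R -> R[i]) : \bar R :=
  Lnorm (@lebesgue_measure R) p%:E
    (fun x => Lnorm (@lebesgue_measure R) +oo%E (fun t => (cmod (F x t))%:E)).

(* The integral defining [propagator fhat t x] is absolutely convergent exactly
   when [fhat] is integrable; no claim is made about other elements of H^{s,p/2},
   for which [cintegral] would return a junk value. *)
Definition maximal_function_inequality (s p C : R) : Prop :=
  forall (f : (R -> R[i]) -> R[i]) (fhat : R -> R[i]),
    in_FL s (p / 2)%:E f fhat -> cintegrable fhat ->
    (mixed_norm p (fun x t => propagator fhat t x)
       <= C%:E * FL_norm s (p / 2)%:E fhat)%E.

End ComplexValued.

(* Main.v *)
(** The frequency-localised packet with Fourier transform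
    [xi |-> (1 + (xi - N)^2)^-2] and N large travels along x = 2 t N and has not
    yet dispersed for |t| small, so that [sup_t |U(t) f(x)|] is bounded below
    for all x in an interval of length comparable to N: the left-hand side is at
    least c N^(1/p).  The right-hand side is at most C N^(max s 0), as the
    profile [(1 + eta^2)^-2] absorbs the weight at distance eta from N.  Letting
    N tend to infinity forces 1/p <= max s 0.

    The profile is chosen because its inverse Fourier transform is a multiple of
    [(1 + |x|) exp(- |x|)], which is integrable: that the distribution given by
    this function has the right Fourier transform is then Fubini's theorem plus
    one explicit integral, and no Fourier inversion is needed. *)

Require Import Defs.
From mathcomp Require Import all_boot all_order all_algebra.
From mathcomp Require Import all_classical all_reals all_analysis.
From mathcomp Require Import complex.
From mathcomp Require Import measurable_realfun ess_sup_inf ring lra.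
Import Order.TTheory GRing.Theory Num.Theory.
Import numFieldNormedType.Exports complex.
Set Implicit Arguments.
Unset Strict Implicit.
Unset Printing Implicit Defensive.
Local Open Scope classical_set_scope.
Local Open Scope ring_scope.
Local Open Scope complex_scope.

(** * Complex-valued integrals *)

Section Cmod.
Context {R : realType}.
Implicit Types z w : R[i].

Lemma cmodE z : cmod z = Num.sqrt (Re z ^+ 2 + Im z ^+ 2).
Proof. by case: z. Qed.

Lemma cmod_ge0 z : 0 <= cmod z.
Proof. by rewrite cmodE sqrtr_ge0. Qed.

Lemma cmodM z w : cmod (z * w) = cmod z * cmod w.
Proof. exact: ComplexField.Normc.normcM. Qed.

Lemma cmod_real (x : R) : cmod x%:C = `|x|.
Proof. by rewrite cmodE /= expr0n addr0 sqrtr_sqr. Qed.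

Lemma cmod_cexpi (x : R) : cmod (cexpi x) = 1.
Proof. by rewrite cmodE /= cos2Dsin2 sqrtr1. Qed.

Lemma norm_Re_le_cmod z : `|Re z| <= cmod z.
Proof.
by rewrite cmodE -sqrtr_sqr ler_wsqrtr// lerDl sqr_ge0.
Qed.

Lemma norm_Im_le_cmod z : `|Im z| <= cmod z.
Proof.
by rewrite cmodE -sqrtr_sqr ler_wsqrtr// lerDr sqr_ge0.
Qed.

Lemma cmod_le_normD z : cmod z <= `|Re z| + `|Im z|.
Proof.
rewrite cmodE -(ler_pXn2r (ltn0Sn 1)) ?nnegrE ?sqrtr_ge0 ?addr_ge0//.
rewrite sqr_sqrtr ?addr_ge0 ?sqr_ge0// sqrrD !real_normK ?num_real//.
by rewrite lerD2r lerDl mulrn_wge0// mulr_ge0.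
Qed.

Lemma Re_mul z w : Re (z * w) = Re z * Re w - Im z * Im w.
Proof. by case: z w => [a b] [c d]. Qed.

Lemma Im_mul z w : Im (z * w) = Re z * Im w + Im z * Re w.
Proof. by case: z w => [a b] [c d]. Qed.

Lemma Re_add z w : Re (z + w) = Re z + Re w.
Proof. by case: z w => [a b] [c d]. Qed.

Lemma Im_add z w : Im (z + w) = Im z + Im w.
Proof. by case: z w => [a b] [c d]. Qed.

Lemma complex_ext z w : Re z = Re w -> Im z = Im w -> z = w.
Proof. by case: z w => [a b] [c d] /= -> ->. Qed.

Lemma cexpiD (x y : R) : cexpi (x + y) = cexpi x * cexpi y.
Proof.
apply: complex_ext; rewrite /cexpi ?Re_mul ?Im_mul /=; first by rewrite cosD.
by rewrite sinD addrC.
Qed.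

End Cmod.

Lemma measurable_cmul d (T : measurableType d) (R : realType) (f g : T -> R[i]) :
  measurable_fun setT (fun x => Re (f x)) /\
    measurable_fun setT (fun x => Im (f x)) ->
  measurable_fun setT (fun x => Re (g x)) /\
    measurable_fun setT (fun x => Im (g x)) ->
  measurable_fun setT (fun x => Re (f x * g x)) /\
    measurable_fun setT (fun x => Im (f x * g x)).
Proof.
move=> [mf1 mf2] [mg1 mg2]; split.
  under eq_fun do rewrite Re_mul.
  by apply: measurable_funB; exact: measurable_funM.
under eq_fun do rewrite Im_mul.
by apply: measurable_funD; exact: measurable_funM.
Qed.

Lemma measurable_cexpi d (T : measurableType d) (R : realType) (u : T -> R) :
  measurable_fun setT u ->
  measurable_fun setT (fun x => Re (cexpi (u x))) /\
    measurable_fun setT (fun x => Im (cexpi (u x))).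
Proof.
move=> mu; split; apply: (measurableT_comp _ mu);
  apply: continuous_measurable_fun; [exact: continuous_cos|exact: continuous_sin].
Qed.

Section ComplexIntegral.
Context {R : realType}.
Notation mu := (@lebesgue_measure R).
Implicit Types (f g : R -> R[i]).

Lemma integrable_dominated (u h : R -> R) :
  measurable_fun setT u -> mu.-integrable setT (fun x => (h x)%:E) ->
  (forall x, `|u x| <= h x) -> mu.-integrable setT (fun x => (u x)%:E).
Proof.
move=> mu_ ih uh; apply: le_integrable ih => //; first exact/measurable_EFinP.
by move=> x _ /=; rewrite lee_fin (le_trans (uh x))// ler_norm.
Qed.

Lemma cintegrable_dominated g (h : R -> R) :
  cmeasurable g -> mu.-integrable setT (fun x => (h x)%:E) ->
  (forall x, cmod (g x) <= h x) -> cintegrable g.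
Proof.
move=> [mRe mIm] ih gh; split; apply: integrable_dominated ih _ => // x.
  exact: le_trans (norm_Re_le_cmod _) (gh x).
exact: le_trans (norm_Im_le_cmod _) (gh x).
Qed.

Lemma cmeasurableM f g : cmeasurable f -> cmeasurable g ->
  cmeasurable (fun x => f x * g x).
Proof. exact: measurable_cmul. Qed.

Lemma cintegralD f g : cintegrable f -> cintegrable g ->
  cintegral (fun x => f x + g x) = cintegral f + cintegral g.
Proof.
move=> [f1 f2] [g1 g2]; apply: complex_ext; rewrite ?Re_add ?Im_add /=.
  by under eq_Rintegral do rewrite Re_add; rewrite RintegralD.
by under eq_Rintegral do rewrite Im_add; rewrite RintegralD.
Qed.

Lemma integrable_scale (a : R) (u : R -> R) :
  mu.-integrable setT (fun x => (u x)%:E) ->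
  mu.-integrable setT (fun x => (a * u x)%:E).
Proof.
by move=> iu; under eq_fun do rewrite EFinM; exact: integrableZl.
Qed.

Lemma cintegralZ (a : R[i]) g : cintegrable g ->
  cintegral (fun x => a * g x) = a * cintegral g.
Proof.
move=> [g1 g2]; apply: complex_ext; rewrite ?Re_mul ?Im_mul /=.
  under eq_Rintegral do rewrite Re_mul.
  by rewrite RintegralB ?RintegralZl//; exact: integrable_scale.
under eq_Rintegral do rewrite Im_mul.
by rewrite RintegralD ?RintegralZl//; exact: integrable_scale.
Qed.

Lemma cintegrableZ (a : R[i]) g : cintegrable g ->
  cintegrable (fun x => a * g x).
Proof.
move=> [g1 g2]; split.
  under eq_fun do rewrite Re_mul EFinB.
  by apply: integrableB => //; exact: integrable_scale.
under eq_fun do rewrite Im_mul EFinD.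
by apply: integrableD => //; exact: integrable_scale.
Qed.

(** Bounding the real and imaginary parts separately costs the factor 2, which is harmless for the
    continuity estimate of a tempered distribution. *)
Lemma cmod_cintegral_le g (h : R -> R) :
  cmeasurable g -> mu.-integrable setT (fun x => (h x)%:E) ->
  (forall x, cmod (g x) <= h x) ->
  cmod (cintegral g) <= 2 * \int[mu]_x h x.
Proof.
move=> mg ih gh; have [iRe iIm] := cintegrable_dominated mg ih gh.
apply: le_trans (cmod_le_normD _) _ => /=; rewrite mulr_natl mulr2n lerD//.
  apply: le_trans (le_normr_Rintegral _ _) _ => //.
  apply: le_Rintegral => //; first exact: integrable_norm.
  by move=> x _; apply: le_trans (gh x); exact: norm_Re_le_cmod.
apply: le_trans (le_normr_Rintegral _ _) _ => //.
apply: le_Rintegral => //; first exact: integrable_norm.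
by move=> x _; apply: le_trans (gh x); exact: norm_Im_le_cmod.
Qed.

(** The majorant is a product of integrable functions, so [F] is integrable on the plane by Tonelli
    and Fubini's theorem applies. *)
Lemma Rintegral_Fubini (F : R -> R -> R) (a b : R -> R) :
  measurable_fun setT (fun z => F z.1 z.2) ->
  mu.-integrable setT (fun x => (a x)%:E) ->
  mu.-integrable setT (fun x => (b x)%:E) ->
  (forall x y, `|F x y| <= a x * b y) ->
  \int[mu]_x \int[mu]_y F x y = \int[mu]_y \int[mu]_x F x y.
Proof.
move=> mF ia ib Fab.
have iF : (mu \x mu)%E.-integrable setT (fun z => (F z.1 z.2)%:E).
  apply/integrable12ltyP; first exact/measurable_EFinP.
  have mab : measurable_fun setT (fun x => `|a x|).
    apply: measurableT_comp => //; apply/measurable_EFinP.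
    exact: (measurable_int mu).
  have mbb : measurable_fun setT (fun x => `|b x|).
    apply: measurableT_comp => //; apply/measurable_EFinP.
    exact: (measurable_int mu).
  have bB x : (\int[mu]_y `|(F x y)%:E| <= (\int[mu]_y (`|b y|)%:E) * (`|a x|)%:E)%E.
    rewrite -ge0_integralZr//; last exact/measurable_EFinP.
    apply: ge0_le_integral => //.
    - apply/measurable_EFinP; apply: measurableT_comp => //.
      exact: (measurableT_comp (f := fun z => F z.1 z.2) (g := pair x) mF).
    - by apply/measurable_EFinP; exact: measurable_funM.
    - move=> y _ /=; rewrite lee_fin (le_trans (Fab x y))// mulrC.
      by rewrite -normrM ler_norm.
  apply: (@le_lt_trans _ _ (\int[mu]_x ((\int[mu]_y (`|b y|)%:E) * (`|a x|)%:E))%E).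
    apply: ge0_le_integral => //=.
    - by move=> x _; exact: integral_ge0.
    - apply: (measurable_fun_fubini_tonelli_F (m2 := mu)
        (fun z => `|(F z.1 z.2)%:E|%E)) => //.
      by apply/measurable_EFinP; apply: measurableT_comp.
    - by apply: emeasurable_funM => //; exact/measurable_EFinP.
    - by move=> x _; exact: bB.
  rewrite ge0_integralZl//; last 2 first.
    exact/measurable_EFinP.
    exact: integral_ge0.
  have fin u : mu.-integrable setT (fun x => (u x)%:E) ->
      (\int[mu]_y (`|u y|)%:E < +oo)%E by case/integrableP.
  by apply: lte_mul_pinfty; rewrite ?integral_ge0 ?ge0_fin_numE ?integral_ge0 ?fin.
rewrite /Rintegral.
have := Fubini iF => /= Fu.
have mF1 x : measurable_fun setT (F x).
  exact: (measurableT_comp (f := fun z => F z.1 z.2) (g := pair x) mF).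
have mF2 y : measurable_fun setT (F ^~ y).
  exact: (measurableT_comp (f := fun z => F z.1 z.2) (g := fun x => (x, y)) mF).
(* [fine] sends an infinite value to 0, so the inner integrals must be shown finite before the real
   iterated integrals agree with the extended ones. *)
transitivity (fine (\int[mu]_x \int[mu]_y (F x y)%:E)%E).
  congr fine; apply: eq_integral => x _; rewrite fineK//.
  apply: integrable_fin_num => //.
  apply: (integrable_dominated (h := fun y => a x * b y)) => //.
  exact: integrable_scale.
rewrite Fu; congr fine; apply: eq_integral => y _; rewrite fineK//.
apply: integrable_fin_num => //.
apply: (integrable_dominated (h := fun x => b y * a x)) => //.
  exact: integrable_scale.
by move=> x; rewrite mulrC.
Qed.

Lemma cintegral_Fubini (F : R -> R -> R[i]) (a b : R -> R) :
  measurable_fun setT (fun z => Re (F z.1 z.2)) ->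
  measurable_fun setT (fun z => Im (F z.1 z.2)) ->
  mu.-integrable setT (fun x => (a x)%:E) ->
  mu.-integrable setT (fun x => (b x)%:E) ->
  (forall x y, cmod (F x y) <= a x * b y) ->
  cintegral (fun x => cintegral (F x)) =
  cintegral (fun y => cintegral (F ^~ y)).
Proof.
move=> mRe mIm ia ib Fab; apply: complex_ext => /=.
  apply: Rintegral_Fubini mRe ia ib _ => x y.
  exact: le_trans (norm_Re_le_cmod _) (Fab x y).
apply: Rintegral_Fubini mIm ia ib _ => x y.
exact: le_trans (norm_Im_le_cmod _) (Fab x y).
Qed.

End ComplexIntegral.

(** * The Fourier transform of (1 + |x|) exp(-|x|) *)

Section RealIntegrals.
Context {R : realType}.
Notation mu := (@lebesgue_measure R).

(** Split at 0 and reflect the negative half. On the half-line [expwt] has an explicit primitive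
    against the cosine, and the folding cancels odd parts. *)
Lemma ge0_integral_fold (G : R -> R) : continuous G -> (forall x, 0 <= G x) ->
  (\int[mu]_x (G x)%:E = \int[mu]_(x in `[0%R, +oo[) (G x + G (- x))%:E)%E.
Proof.
move=> cG G0.
have mG : measurable_fun setT G by exact: continuous_measurable_fun.
have cGN : continuous (G \o -%R).
  by move=> x; apply: continuous_comp; [exact: opp_continuous|exact: cG].
have mGN : measurable_fun setT (G \o -%R) by exact: continuous_measurable_fun.
have mp : measurable [set x : R | 0 <= x] by rewrite -set_itvcy.
rewrite -(setUv [set x : R | 0 <= x]) ge0_integral_setU//=; last 4 first.

- exact: measurableC.
- by apply/measurable_EFinP; rewrite setUv.
- by move=> x _; rewrite lee_fin.
- exact/disj_setPCl.
rewrite -set_itvcy setCitvr integral_itv_bndo_bndc; last first.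
  exact/measurable_EFinP/measurable_funTS.
rewrite -{2}oppr0 ge0_integration_by_substitutionNy//; last first.
  exact: continuous_subspaceT.
rewrite -ge0_integralD//.
- by move=> x _; rewrite lee_fin.
- exact/measurable_EFinP/measurable_funTS.
- by move=> x _; rewrite lee_fin /=.
- exact/measurable_EFinP/measurable_funTS.
Qed.

Lemma ge0_integral_shift (G : R -> R) (N : R) : continuous G ->
  (forall x, 0 <= G x) ->
  (\int[mu]_x (G (x - N))%:E = \int[mu]_x (G x)%:E)%E.
Proof.
move=> cG G0.
have dF : derive1 (fun x : R => x - N) = cst 1.
  by apply/funext => x; rewrite derive1E derive_val subr0.
rewrite [RHS](increasing_ge0_integration_by_substitutionT (F := fun x => x - N))//.
- by apply: eq_integral => x _; rewrite dF /= mulr1.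
- by move=> x y xy; rewrite ltrD2r.
- by rewrite dF; exact: cst_continuous.
- by rewrite dF; exact: is_cvg_cst.
- by rewrite dF; exact: is_cvg_cst.
- exact: cvg_addrr_Ny.
- exact: cvg_addrr.
Qed.

Lemma integral_oneDsqrV :
  (\int[mu]_x ((1 + x ^+ 2)^-1)%:E = pi%:E)%E.
Proof.
rewrite ge0_symfun_integralT.
- rewrite -set_itvcy integral0y_oneDsqr -EFinM; congr EFin; lra.
- by move=> x; rewrite invr_ge0 addr_ge0// sqr_ge0.
- exact: continuous_oneDsqrV.
- by move=> x /=; rewrite sqrrN.
Qed.

Lemma integral_oneDsqrV_shift (N : R) :
  (\int[mu]_x ((1 + (x - N) ^+ 2)^-1)%:E = pi%:E)%E.
Proof.
rewrite -integral_oneDsqrV.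
rewrite (ge0_integral_shift (G := fun x => (1 + x ^+ 2)^-1))//.
- exact: continuous_oneDsqrV.
- by move=> x; rewrite invr_ge0 addr_ge0// sqr_ge0.
Qed.

Lemma continuous_oneDsqrV_shift (N : R) :
  continuous (fun x : R => (1 + (x - N) ^+ 2)^-1).
Proof.
move=> x.
apply: (continuous_comp (f := fun x => x - N) (g := fun x => (1 + x ^+ 2)^-1)).
  by apply: cvgB; [exact: cvg_id|exact: cvg_cst].
exact: continuous_oneDsqrV.
Qed.

Lemma integrable_oneDsqrV_shift (N : R) :
  mu.-integrable setT (fun x => ((1 + (x - N) ^+ 2)^-1)%:E).
Proof.
apply/integrableP; split.
  apply/measurable_EFinP; apply: continuous_measurable_fun.
  exact: continuous_oneDsqrV_shift.
under eq_integral => x _.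
  rewrite /= ger0_norm; last by rewrite invr_ge0 addr_ge0// sqr_ge0.
  over.
by rewrite integral_oneDsqrV_shift ltry.
Qed.

(* Real part of the primitive - exp(- z x) ((1 + x) / z + 1 / z^2) of
   (1 + x) exp(- z x), for z = 1 - i e. *)
Definition expcos_primitive (e x : R) : R :=
  - (expR (- x) * ((1 + x) * (cos (e * x) - e * sin (e * x)) / (1 + e ^+ 2) +
      ((1 - e ^+ 2) * cos (e * x) - 2 * e * sin (e * x)) / (1 + e ^+ 2) ^+ 2)).

Lemma is_derive_expcos_primitive (e x : R) :
  is_derive x 1 (expcos_primitive e) ((1 + x) * expR (- x) * cos (e * x)).
Proof.
rewrite /expcos_primitive.
have d1 : is_derive x 1 (fun x => expR (- x)) (- expR (- x)).
  by have := is_derive1_comp (is_derive_expR (- x)) (is_deriveNid x 1);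
    rewrite mulrN1.
have de : is_derive x 1 ( *%R e) e.
  by have := is_deriveZ e (is_derive_id x 1); rewrite /GRing.scale /= mulr1.
have dc : is_derive x 1 (fun x => cos (e * x)) (- e * sin (e * x)).
  have := @is_derive1_comp R cos ( *%R e) x _ _ (is_derive_cos _) de.
  by rewrite mulrC mulrN mulNr.
have ds : is_derive x 1 (fun x => sin (e * x)) (e * cos (e * x)).
  by have := @is_derive1_comp R sin ( *%R e) x _ _ (is_derive_sin _) de;
    rewrite mulrC.
apply: is_derive_eq; rewrite /GRing.scale /=; field.
by rewrite gt_eqF// ltr_wpDr ?sqr_ge0.
Qed.

(** Half of the exponential absorbs the linear factor, since [1 + x / 2 <= expR (x / 2)]. *)
Lemma onePx_expR_le (x : R) : 0 <= x -> (1 + x) * expR (- x) <= 2 * expR (- (x / 2)).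
Proof.
move=> x0; rewrite (_ : - x = - (x / 2) + - (x / 2)); last by field.
rewrite expRD mulrA ler_wpM2r ?expR_ge0// expRN ler_pdivrMr ?expR_gt0//.
by have := expR_ge1Dx (x / 2); lra.
Qed.

Lemma cvg_expcos_primitive (e : R) : expcos_primitive e x @[x --> +oo] --> 0.
Proof.
(* The two summands bound the two trigonometric numerators of the primitive; both denominators are
   at least 1. *)
pose K := (1 + `|e|) + (1 + e ^+ 2 + 2 * `|e|).
have K0 : 0 <= K by rewrite /K; have := normr_ge0 e; have := sqr_ge0 e; lra.
have bF (x : R) : 0 <= x -> `|expcos_primitive e x| <= K * 2 * expR (- (x / 2)).
  move=> x0; rewrite normrN normrM ger0_norm ?expR_ge0//.
  apply: (@le_trans _ _ (K * (1 + x) * expR (- x))); last first.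
    by rewrite -2!mulrA ler_wpM2l// onePx_expR_le.
  rewrite [leRHS]mulrC ler_wpM2l ?expR_ge0//.
  have C1 : `|cos (e * x)| <= 1 by rewrite ler_norml cos_geN1 cos_le1.
  have S1 : `|sin (e * x)| <= 1 by rewrite ler_norml sin_geN1 sin_le1.
  have D1 : 1 <= 1 + e ^+ 2 by rewrite lerDl sqr_ge0.
  have D2 : 1 <= (1 + e ^+ 2) ^+ 2 by rewrite exprn_ege1.
  have divD (a d : R) : 1 <= d -> `|a / d| <= `|a|.
    move=> d1; have d0 : 0 < d := lt_le_trans ltr01 d1.
    by rewrite normrM normfV (gtr0_norm d0) ler_pdivrMr// ler_peMr.
  apply: le_trans (ler_normD _ _) _; rewrite [leRHS]mulrDl lerD//.
    apply: le_trans (divD _ _ D1) _.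
    rewrite normrM mulrC (@ger0_norm _ (1 + x)) ?addr_ge0//.
    rewrite ler_wpM2r ?addr_ge0// (le_trans (ler_normB _ _))// lerD//.
    by rewrite normrM ler_piMr.
  apply: le_trans (divD _ _ D2) _.
  apply: (@le_trans _ _ (1 + e ^+ 2 + 2 * `|e|)); last first.
    by rewrite ler_peMr ?lerDl//; have := normr_ge0 e; have := sqr_ge0 e; lra.
  rewrite (le_trans (ler_normB _ _))// lerD//.
    rewrite normrM -[leRHS]mulr1 ler_pM// (le_trans (ler_normB _ _))//.
    by rewrite normr1 ger0_norm ?sqr_ge0.
  by rewrite !normrM (@ger0_norm _ 2)// ler_piMr ?mulr_ge0.
have c0 : K * 2 * expR (- (x / 2)) @[x --> +oo] --> 0.
  rewrite -[X in _ --> X](mulr0 (K * 2)); apply: cvgM; first exact: cvg_cst.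
  apply: (@cvg_comp _ _ _ (fun x : R => x / 2) (fun x => expR (- x)) _
    (pinfty_nbhs R)).
    by apply: gt0_cvgMly.
  exact: cvgr_expR.
apply: (squeeze_cvgr (f := fun x => - (K * 2 * expR (- (x / 2))))
  (h := fun x => K * 2 * expR (- (x / 2)))).
- near=> x; rewrite -ler_norml; apply: bF; near: x; exact: nbhs_pinfty_ge.
- by rewrite -oppr0; apply: cvgN.
- exact: c0.
Unshelve. all: by end_near.
Qed.

Definition expwt (x : R) : R := (1 + `|x|) * expR (- `|x|).

Lemma expwt_ge0 x : 0 <= expwt x.
Proof. by rewrite mulr_ge0 ?addr_ge0 ?expR_ge0. Qed.

Lemma expwtN x : expwt (- x) = expwt x.
Proof. by rewrite /expwt normrN. Qed.

Lemma continuous_expwt : continuous expwt.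
Proof.
move=> x; apply: cvgM.
  by apply: cvgD; [exact: cvg_cst|exact: norm_continuous].
apply: (continuous_comp (f := fun x : R => - `|x|)); last exact: continuous_expR.
by apply: cvgN; exact: norm_continuous.
Qed.

Lemma continuous_cosM (e : R) : continuous (fun x => cos (e * x)).
Proof.
move=> x; apply: (continuous_comp (f := *%R e)); last exact: continuous_cos.
exact: mulrl_continuous.
Qed.

Lemma continuous_sinM (e : R) : continuous (fun x => sin (e * x)).
Proof.
move=> x; apply: (continuous_comp (f := *%R e)); last exact: continuous_sin.
exact: mulrl_continuous.
Qed.

(* The summand 1 keeps the integrand nonnegative, as required by the fundamental
   theorem of calculus on a half-line. *)
Lemma integral0y_expwt_onePcos (e : R) :
  (\int[mu]_(x in `[0%R, +oo[) (expwt x * (1 + cos (e * x)))%:E =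
   (2 + 2 / (1 + e ^+ 2) ^+ 2)%:E)%E.
Proof.
have cf : continuous (fun x => expwt x * (1 + cos (e * x))).
  move=> x; apply: cvgM; first exact: continuous_expwt.
  by apply: cvgD; [exact: cvg_cst|exact: continuous_cosM].
(* At frequency 0 the cosine is 1, so the first summand is a primitive of [expwt] itself on the
   half-line. *)
pose F x := expcos_primitive 0 x + expcos_primitive e x.
have dF (x : R) : is_derive x 1 F
    ((1 + x) * expR (- x) * cos (0 * x) + (1 + x) * expR (- x) * cos (e * x)).
  by apply: is_deriveD; exact: is_derive_expcos_primitive.
have DF (x : R) : derivable F x 1 by have [] := dF x.
rewrite (@ge0_continuous_FTC2y _ _ F 0 0).
- rewrite -EFinB; congr EFin; rewrite /F /expcos_primitive.
  rewrite !mulr0 oppr0 expR0 cos0 sin0; field.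
  by rewrite gt_eqF// ltr_wpDr ?sqr_ge0.
- move=> x _; apply: mulr_ge0; first exact: expwt_ge0.
  by have := cos_geN1 (e * x); lra.
- exact: continuous_subspaceT.
- by rewrite -[X in _ --> X](addr0 0); apply: cvgD; exact: cvg_expcos_primitive.
- by move=> x _.
- apply: cvg_at_right_filter.
  exact/differentiable_continuous/derivable1_diffP/DF.
- move=> x; rewrite in_itv/= andbT => x0; rewrite derive1E derive_val.
  by rewrite mul0r cos0 /expwt gtr0_norm//; ring.
Qed.

Lemma integral_expwt : (\int[mu]_x (expwt x)%:E = 4%:E)%E.
Proof.
rewrite ge0_integral_fold; [|exact: continuous_expwt|exact: expwt_ge0].
have := integral0y_expwt_onePcos 0; rewrite (_ : 2 + _ = 4); last by field.
by move=> <-; apply: eq_integral => x _; rewrite mul0r cos0 expwtN; congr EFin; ring.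
Qed.

Lemma integrable_expwt : mu.-integrable setT (fun x => (expwt x)%:E).
Proof.
apply/integrableP; split.
  apply/measurable_EFinP; apply: continuous_measurable_fun.
  exact: continuous_expwt.
under eq_integral => x _.
  rewrite /= ger0_norm; last exact: expwt_ge0.
  over.
by rewrite integral_expwt ltry.
Qed.

Lemma integrable_expwt_cos (e : R) :
  mu.-integrable setT (fun x => (expwt x * cos (e * x))%:E).
Proof.
apply: (integrable_dominated _ integrable_expwt) => [|x].
  apply: measurable_funM; apply: continuous_measurable_fun.
    exact: continuous_expwt.
  exact: continuous_cosM.
rewrite normrM ger0_norm ?expwt_ge0// ler_piMr ?expwt_ge0//.
by rewrite ler_norml cos_geN1 cos_le1.
Qed.

Lemma integrable_expwt_sin (e : R) :
  mu.-integrable setT (fun x => (expwt x * sin (e * x))%:E).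
Proof.
apply: (integrable_dominated _ integrable_expwt) => [|x].
  apply: measurable_funM; apply: continuous_measurable_fun.
    exact: continuous_expwt.
  exact: continuous_sinM.
rewrite normrM ger0_norm ?expwt_ge0// ler_piMr ?expwt_ge0//.
by rewrite ler_norml sin_geN1 sin_le1.
Qed.

(** Adding [expwt] makes the integrand nonnegative, so that it can be folded; the integral 4 of
    [expwt] is cancelled at the end. *)
Lemma Rintegral_expwt_cos (e : R) :
  \int[mu]_x (expwt x * cos (e * x)) = 4 / (1 + e ^+ 2) ^+ 2.
Proof.
have ic := integrable_expwt_cos e.
have : \int[mu]_x (expwt x + expwt x * cos (e * x)) = 4 + 4 / (1 + e ^+ 2) ^+ 2.
  rewrite /Rintegral ge0_integral_fold.
  - rewrite (_ : 4 + _ = 2 * (2 + 2 / (1 + e ^+ 2) ^+ 2)); last by ring.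
    rewrite -[RHS]/(fine (2 * (2 + 2 / (1 + e ^+ 2) ^+ 2))%:E) EFinM.
    rewrite -integral0y_expwt_onePcos -ge0_integralZl_EFin//.
    + congr fine; apply: eq_integral => x _; rewrite -EFinM; congr EFin.
      by rewrite expwtN mulrN cosN; ring.
    + by move=> x _; rewrite lee_fin mulr_ge0 ?expwt_ge0//;
        have := cos_geN1 (e * x); lra.
    + apply/measurable_EFinP; apply: measurable_funTS.
      apply: continuous_measurable_fun => x.
      apply: cvgM; first exact: continuous_expwt.
      by apply: cvgD; [exact: cvg_cst|exact: continuous_cosM].
  - move=> x; apply: cvgD; first exact: continuous_expwt.
    by apply: cvgM; [exact: continuous_expwt|exact: continuous_cosM].
  - move=> x; rewrite -[X in X + _]mulr1 -mulrDr.
    apply: mulr_ge0; first exact: expwt_ge0.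
    by have := cos_geN1 (e * x); lra.
rewrite RintegralD//; last exact: integrable_expwt.
by rewrite {1}/Rintegral integral_expwt /= => /addrI.
Qed.

(** The same device: folding [expwt x * (1 + sin (e * x))] removes the odd sine and leaves the
    integral 4 of [expwt]. *)
Lemma Rintegral_expwt_sin (e : R) : \int[mu]_x (expwt x * sin (e * x)) = 0.
Proof.
have ic := integrable_expwt_sin e.
have : \int[mu]_x (expwt x + expwt x * sin (e * x)) = 4.
  rewrite /Rintegral ge0_integral_fold.
  - transitivity (fine (4%:E : \bar R)) => //.
    have := integral0y_expwt_onePcos 0; rewrite (_ : 2 + _ = 4); last by field.
    move=> <-; congr fine; apply: eq_integral => x _.
    by rewrite expwtN mulrN sinN mul0r cos0; congr EFin; ring.
  - move=> x; apply: cvgD; first exact: continuous_expwt.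
    by apply: cvgM; [exact: continuous_expwt|exact: continuous_sinM].
  - move=> x; rewrite -[X in X + _]mulr1 -mulrDr.
    apply: mulr_ge0; first exact: expwt_ge0.
    by have := sin_geN1 (e * x); lra.
rewrite RintegralD//; last exact: integrable_expwt.
rewrite {1}/Rintegral integral_expwt /= => H.
by apply: (addrI 4); rewrite H addr0.
Qed.

End RealIntegrals.

(** * The wave packet as a tempered distribution *)

Section Schwartz.
Context {R : realType}.
Implicit Types phi psi : R -> R[i].

Lemma smooth_continuous (u : R -> R) : smooth u -> continuous u.
Proof.
by move=> su x; exact/differentiable_continuous/derivable1_diffP/(su 0%N x).
Qed.

Lemma cmeasurable_schwartz phi : schwartz phi -> cmeasurable phi.
Proof.
by move=> [sRe sIm _]; split; apply: continuous_measurable_fun;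
  exact: smooth_continuous.
Qed.

Lemma cderiv0 phi x : cderiv 0 phi x = phi x.
Proof. by rewrite /cderiv /=; case: (phi x). Qed.

Lemma cmod_le_seminorm phi x : schwartz phi ->
  cmod (phi x) <= schwartz_seminorm 0 0 phi.
Proof.
move=> [_ _ /(_ 0%N 0%N)[M HM]]; apply: ub_le_sup.
  by exists M => _ [y _ <-]; exact: HM.
by exists x => //; rewrite expr0 mul1r cderiv0.
Qed.

(** Adding the seminorm bounds with weights 1 and [|x|^2] gives an integrable majorant, as Fubini's
    theorem requires. *)
Lemma schwartz_decay phi : schwartz phi ->
  exists M, forall x, cmod (phi x) <= M * (1 + x ^+ 2)^-1.
Proof.
move=> [_ _ sphi]; have [A HA] := sphi 0%N 0%N; have [B HB] := sphi 2%N 0%N.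
exists (A + B) => x; rewrite ler_pdivlMr ?ltr_wpDr ?sqr_ge0//.
have := HA x; have := HB x; rewrite cderiv0 expr0 real_normK ?num_real//.
by lra.
Qed.

End Schwartz.

Section WavePacket.
Context {R : realType}.
Notation mu := (@lebesgue_measure R).
Variable N : R.

(** The inverse Fourier transform of [packet_hat]. The constant compensates the factor
    [(2 pi)^(-1/2)] of [fourier] and the 4 in [Rintegral_expwt_cos]; the exponential moves the
    frequency to [N]. *)
Definition packet (x : R) : R[i] :=
  (Num.sqrt (2 * pi) / 4 * expwt x)%:C * cexpi (N * x).

Definition packet_hat (xi : R) : R[i] := ((1 + (xi - N) ^+ 2)^-1 ^+ 2)%:C.

Definition packet_dist (psi : R -> R[i]) : R[i] :=
  cintegral (fun x => packet x * psi x).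

Let k : R := Num.sqrt (2 * pi) / 4.

Let k_ge0 : 0 <= k. Proof. by rewrite divr_ge0 ?sqrtr_ge0. Qed.

Lemma cmod_packet x : cmod (packet x) = k * expwt x.
Proof.
by rewrite cmodM cmod_cexpi cmod_real mulr1 ger0_norm// mulr_ge0 ?expwt_ge0.
Qed.

Lemma cmeasurable_packet : cmeasurable packet.
Proof.
apply: measurable_cmul; last first.
  by apply: measurable_cexpi; exact: mulrl_measurable.
split => /=; last exact: measurable_cst.
apply: measurable_funM; first exact: measurable_cst.
by apply: continuous_measurable_fun; exact: continuous_expwt.
Qed.

Lemma cmeasurable_packet_hat : cmeasurable packet_hat.
Proof.
split => /=; last exact: measurable_cst.
apply: measurable_funX.
by apply: continuous_measurable_fun; exact: continuous_oneDsqrV_shift.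
Qed.

Lemma packet_hat_bounds xi :
  0 < (1 + (xi - N) ^+ 2)^-1 <= 1.
Proof.
have D1 : 1 <= 1 + (xi - N) ^+ 2 by rewrite lerDl sqr_ge0.
by rewrite invr_gt0 (lt_le_trans ltr01 D1) invf_le1// (lt_le_trans ltr01 D1).
Qed.

Lemma cmod_packet_hat xi : cmod (packet_hat xi) = (1 + (xi - N) ^+ 2)^-1 ^+ 2.
Proof.
by rewrite cmod_real ger0_norm// sqr_ge0.
Qed.

Lemma integrable_packetM (M : R) :
  mu.-integrable setT (fun x => (k * M * expwt x)%:E).
Proof. by apply: integrable_scale; exact: integrable_expwt. Qed.

Lemma packetM_bound (psi : R -> R[i]) (M : R) x :
  cmod (psi x) <= M -> cmod (packet x * psi x) <= k * M * expwt x.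
Proof.
move=> pM; rewrite cmodM cmod_packet mulrAC ler_wpM2r ?expwt_ge0//.
by rewrite ler_wpM2l.
Qed.

(** The packet is integrable, so pairing with it is controlled by the sup norm of the test function,
    which is the seminorm with both indices 0. *)
Lemma tempered_packet : tempered packet_dist.
Proof.
have bd phi : schwartz phi -> forall x,
    cmod (packet x * phi x) <= k * schwartz_seminorm 0 0 phi * expwt x.
  by move=> sphi x; apply: packetM_bound; exact: cmod_le_seminorm.
have mP phi : schwartz phi -> cmeasurable (fun x => packet x * phi x).
  move=> sphi; apply: cmeasurableM; first exact: cmeasurable_packet.
  exact: cmeasurable_schwartz.
have ip phi : schwartz phi -> cintegrable (fun x => packet x * phi x).
  move=> sphi; apply: cintegrable_dominated (bd _ sphi); first exact: mP.
  exact: integrable_packetM.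
split.
  move=> a phi psi sphi spsi; rewrite /packet_dist.
  rewrite -(cintegralZ a (ip _ sphi)) -cintegralD.
  - by congr cintegral; apply/funext => x; rewrite mulrDr mulrCA.
  - exact/cintegrableZ/ip.
  - exact: ip.
(* [k * 4] is the L^1 norm of the packet, and the 2 comes from [cmod_cintegral_le]. *)
exists (2 * (k * 4)), 0%N => phi sphi; rewrite !big_ord1.
apply: le_trans (cmod_cintegral_le (mP _ sphi) (integrable_packetM _) (bd _ sphi)) _.
rewrite RintegralZl//; last exact: integrable_expwt.
rewrite /Rintegral integral_expwt /=.
by rewrite le_eqVlt; apply/orP; left; apply/eqP; ring.
Qed.

(** The modulation merges with the Fourier kernel into a phase of frequency [xi - N]; the real part
    is the cosine integral and the imaginary part the vanishing sine integral. *)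
Lemma fourier_packet xi : fourier packet xi = packet_hat xi.
Proof.
have s0 : Num.sqrt (2 * pi) != 0 :> R.
  by rewrite gt_eqF// sqrtr_gt0 mulr_gt0// pi_gt0.
have E x : cexpi (- (x * xi)) * packet x =
    (k * (expwt x * cos ((xi - N) * x))) +i* (- k * (expwt x * sin ((xi - N) * x))).
  rewrite /packet mulrCA -cexpiD -/k.
  rewrite (_ : - (x * xi) + N * x = - ((xi - N) * x)); last by ring.
  by apply: complex_ext; rewrite ?Re_mul ?Im_mul /= ?cosN ?sinN; ring.
rewrite /fourier; under [X in cintegral X]eq_fun do rewrite E.
have iC := integrable_expwt_cos (xi - N).
have iS := integrable_expwt_sin (xi - N).
apply: complex_ext; rewrite ?Re_mul ?Im_mul /= !RintegralZl//;
  rewrite Rintegral_expwt_cos Rintegral_expwt_sin; last by ring.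
rewrite /k; field; rewrite s0/=.
by rewrite gt_eqF// ltr_wpDr ?sqr_ge0.
Qed.

(** The multiplication formula: the Fourier transform passes from the test function to the packet by
    exchanging the two integrals. *)
Lemma is_fourier_of_packet : is_fourier_of packet_dist packet_hat.
Proof.
split; first exact: cmeasurable_packet_hat.
move=> phi sphi; have mphi := cmeasurable_schwartz sphi.
have [M HM] := schwartz_decay sphi.
have iM : mu.-integrable setT (fun x => (M * (1 + x ^+ 2)^-1)%:E).
  apply: integrable_scale; have := integrable_oneDsqrV_shift (0 : R).
  by under eq_fun do rewrite subr0.
split.
  apply: (cintegrable_dominated _ iM).
    by apply: cmeasurableM => //; exact: cmeasurable_packet_hat.
  move=> x; rewrite cmodM cmod_packet_hat; apply: le_trans (HM x).
  have /andP[a0 a1] := packet_hat_bounds x.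
  by rewrite ler_piMl ?cmod_ge0// exprn_ile1// ltW.
pose c : R[i] := ((Num.sqrt (2 * pi))^-1)%:C.
pose F (x y : R) := (packet x * c) * (cexpi (- (y * x)) * phi y).
have icphi x : cintegrable (fun y => cexpi (- (y * x)) * phi y).
  apply: (cintegrable_dominated _ iM).
    apply: cmeasurableM => //; apply: measurable_cexpi.
    by apply: measurableT_comp => //; exact: mulrr_measurable.
  by move=> y; rewrite cmodM cmod_cexpi mul1r.
transitivity (cintegral (fun x => cintegral (F x))).
  rewrite /packet_dist; congr cintegral; apply/funext => x.
  by rewrite /fourier mulrA cintegralZ.
have [mF1 mF2] : measurable_fun setT (fun z => Re (F z.1 z.2)) /\
    measurable_fun setT (fun z => Im (F z.1 z.2)).
  have [p1 p2] := cmeasurable_packet; have [q1 q2] := mphi.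
  apply: measurable_cmul; apply: measurable_cmul.
  - by split; [exact: (measurableT_comp p1)|exact: (measurableT_comp p2)].
  - by split; exact: measurable_cst.
  - apply: measurable_cexpi; apply: measurableT_comp => //.
    exact: measurable_funM.
  - by split; [exact: (measurableT_comp q1)|exact: (measurableT_comp q2)].
rewrite (@cintegral_Fubini _ F (fun x => (k * cmod c * expwt x))
  (fun y => M * (1 + y ^+ 2)^-1))//.
- congr cintegral; apply/funext => y; rewrite -fourier_packet /fourier.
  rewrite -/c [RHS]mulrAC -cintegralZ.
    by congr cintegral; apply/funext => x; rewrite /F [y * x]mulrC; ring.
  apply: (cintegrable_dominated _ (integrable_packetM 1)).
    apply: cmeasurableM; last exact: cmeasurable_packet.
    apply: measurable_cexpi; apply: measurableT_comp => //.
    exact: mulrr_measurable.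
  by move=> x; rewrite cmodM cmod_cexpi mul1r cmod_packet mulr1.
- exact: integrable_packetM.
- move=> x y; rewrite /F cmodM (cmodM (packet x)) cmod_packet.
  rewrite (cmodM (cexpi _)) cmod_cexpi mul1r.
  rewrite ler_pM ?mulr_ge0 ?cmod_ge0 ?expwt_ge0//.
  by rewrite mulrAC.
Qed.

End WavePacket.

(** * Norm estimates *)

Section Norms.
Context {R : realType}.
Notation mu := (@lebesgue_measure R).

(** The integral of a nonnegative function is a supremum over the simple functions below it, which
    grows with the function. In this form it applies directly to the inner norm of [mixed_norm] as a
    function of [x]. *)
Lemma le_ge0_integral d (T : measurableType d) (m : {measure set T -> \bar R})
    (f g : T -> \bar R) : (forall x, 0 <= f x)%E -> (forall x, f x <= g x)%E ->
  (\int[m]_x f x <= \int[m]_x g x)%E.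
Proof.
move=> f0 fg.
rewrite !ge0_integralTE//; last by move=> x; exact: le_trans (fg x).
apply: le_ereal_sup => _ [h /= hf <-]; exists h => //= x.
exact: le_trans (fg x).
Qed.

Lemma lee_poweR (r : R) (x y : \bar R) : 0 <= r -> (0 <= x)%E -> (x <= y)%E ->
  (x `^ r <= y `^ r)%E.
Proof.
move=> r0 x0 xy; apply: gt0_ler_poweR; rewrite // in_itv/= leey andbT//.
exact: le_trans xy.
Qed.

(** Chebyshev's inequality, by comparing [|f|^p] with [c^p] times the indicator of [D]. *)
Lemma Lnorm_ge_cst_on (p c : R) (D : set R) (f : R -> \bar R) : 0 < p -> 0 <= c ->
  measurable D -> (forall x, D x -> c%:E <= `|f x|)%E ->
  (c%:E * mu D `^ p^-1 <= Lnorm mu p%:E f)%E.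
Proof.
move=> p0 c0 mD cf; rewrite unlock.
have -> : (c%:E * mu D `^ p^-1)%E =
    ((\int[mu]_x ((c `^ p)%:E * (\1_D x)%:E)) `^ p^-1)%E.
  rewrite ge0_integralZl_EFin ?powR_ge0//; last first.
    exact/measurable_EFinP/measurable_indic.
  rewrite integral_indic// setIT poweRM ?lee_fin ?powR_ge0//.
  by rewrite poweR_EFin -powRrM mulfV ?gt_eqF// powRr1.
apply: lee_poweR; first by rewrite invr_ge0 ltW.
  by apply: integral_ge0 => x _; rewrite -EFinM lee_fin mulr_ge0 ?powR_ge0.
apply: le_ge0_integral => x; first by rewrite -EFinM lee_fin mulr_ge0 ?powR_ge0.
rewrite indicE; have [xD|xD] := boolP (x \in D).
  rewrite mule1 -poweR_EFin; apply: lee_poweR => //; first exact: ltW.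
  by apply: cf; rewrite inE in xD.
by rewrite mule0 poweR_ge0.
Qed.

(** Were the essential supremum below [c], then [D] would lie in a null set. *)
Lemma Lnormy_ge_cst_on (c : R) (D : set R) (f : R -> \bar R) :
  measurable D -> (0 < mu D)%E -> (forall x, D x -> c%:E <= `|f x|)%E ->
  (c%:E <= Lnorm mu +oo f)%E.
Proof.
(* The norm of exponent [+oo] is an essential supremum only when the whole space has positive
   measure; its default value is 0. *)
move=> mD D0 cf; rewrite unlock ifT; last first.
  by apply: lt_le_trans D0 _; apply: le_measure; rewrite ?inE.
rewrite leNgt; apply/negP => fc.
have aeN : (\forall x \ae mu, ~ D x).
  apply: filterS (ess_sup_ge mu (abse \o f)) => x fx /cf.
  by rewrite leNgt => /negP; apply; exact: le_lt_trans fx fc.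
have : mu D = 0%E.
  have [A [mA A0 DA]] := aeN.
  apply/eqP; rewrite eq_le measure_ge0 andbT -A0.
  by apply: le_measure; rewrite ?inE// => x Dx; apply: DA => /= /(_ Dx).
by move=> E; rewrite E ltxx in D0.
Qed.

(** The profile is at most 1, so its power [q] is at most itself and integrates to at most [pi];
    then [pi^(1/q) <= pi]. One bound thus serves all exponents, including [q = +oo], which is dual
    to [p / 2] when [p = 2]. *)
Lemma Lnorm_oneDsqrV_le (q : \bar R) (A N : R) (g : R -> R) :
  (1 <= q)%E -> 0 <= A -> measurable_fun setT g ->
  (forall x, 0 <= g x <= A * (1 + (x - N) ^+ 2)^-1) ->
  (Lnorm mu q (fun x => (g x)%:E) <= (A * pi)%:E)%E.
Proof.
move=> q1 A0 mg gA.
have pi1 : 1 <= pi :> R by rewrite (le_trans _ (pi_ge2 R))// ler1n.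
have D01 (x : R) : 0 < (1 + (x - N) ^+ 2)^-1 <= 1 := packet_hat_bounds N x.
rewrite unlock; case: q q1 => [q|_|//].
  rewrite lee_fin => q1; have q0 : 0 < q by rewrite (lt_le_trans ltr01).
  apply: (@le_trans _ _ ((A `^ q * pi)%:E `^ q^-1)%E); last first.
    rewrite poweR_EFin lee_fin powRM ?powR_ge0 ?pi_ge0//.
    rewrite -powRrM mulfV ?gt_eqF// powRr1// ler_wpM2l//.
    rewrite -[leRHS]powRr1 ?pi_ge0//; apply: ler_powR => //.
    by rewrite invf_le1.
  apply: lee_poweR; first by rewrite invr_ge0 ltW.
    by apply: integral_ge0 => x _; exact: poweR_ge0.
  rewrite EFinM -(integral_oneDsqrV_shift N) -ge0_integralZl_EFin;
    rewrite ?powR_ge0//; last 2 first.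
  - by move=> x _; rewrite lee_fin; have /andP[/ltW] := D01 x.
  - apply/measurable_EFinP; apply: continuous_measurable_fun.
    exact: continuous_oneDsqrV_shift.
  apply: le_ge0_integral => x; first exact: poweR_ge0.
  have /andP[g0 gx] := gA x; have /andP[d0 d1] := D01 x.
  rewrite /= ger0_norm// -EFinM lee_fin.
  apply: (@le_trans _ _ ((A * (1 + (x - N) ^+ 2)^-1) `^ q)).
    by apply: ge0_ler_powR; rewrite ?nnegrE ?mulr_ge0 ?(ltW d0) ?(ltW q0).
  rewrite powRM ?(ltW d0)// ler_wpM2l ?powR_ge0//.
  by apply: ge1r_powR.
case: ifP => [_|_]; last by rewrite lee_fin mulr_ge0 ?pi_ge0.
apply/ess_supP; apply: nearW => x /=.
have /andP[g0 gx] := gA x; have /andP[d0 d1] := D01 x.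
rewrite lee_fin ger0_norm//; apply: (le_trans gx).
by rewrite ler_wpM2l// (le_trans d1).
Qed.

End Norms.

(** * Bounds for the packet: Sobolev weight and evolution *)

Section Bounds.
Context {R : realType}.
Notation mu := (@lebesgue_measure R).
Implicit Types N s x t : R.

(** By evenness take [x >= 0], where [cos z + z] has derivative [1 - sin z >= 0]. A linear loss is
    what [cmod_propagator_packet_ge] can afford: the square of its phase bound would not be
    integrable against the profile. *)
Lemma cos_ge1B_norm x : 1 - `|x| <= cos x.
Proof.
wlog x0 : x / 0 <= x => [H|].
  have [/H//|/ltW x0] := leP 0 x.
  by have := H (- x); rewrite oppr_ge0 normrN cosN; exact.
have dF (y : R) : is_derive y 1 (fun z : R => cos z + z) (- sin y + 1).
  exact: is_deriveD.
have cF : {within `[0, x], continuous (fun z : R => cos z + z)}.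
  apply: continuous_subspaceT => y.
  by apply/differentiable_continuous/derivable1_diffP; have [] := dF y.
have [c _] := MVT_segment x0 (fun y _ => dF y) cF.
rewrite cos0 addr0 subr0 => E; rewrite ger0_norm//.
have : 0 <= (- sin c + 1) * x by rewrite mulr_ge0// addrC subr_ge0 sin_le1.
by rewrite -E; lra.
Qed.

(** The weight costs [N^s'] and at most one factor [D]. One of the two inverse powers of [D] pays
    for that factor, and the other remains for integrability. *)
Lemma japanese_packet_le s N xi : s <= 1 -> 1 <= N ->
  japanese s xi * (1 + (xi - N) ^+ 2)^-1 ^+ 2 <=
  3 * N `^ Num.max s 0 * (1 + (xi - N) ^+ 2)^-1.
Proof.
move=> s1 N1; set s' := Num.max s 0.
have s'0 : 0 <= s' by rewrite le_max lexx orbT.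
have s'1 : s' <= 1 by rewrite ge_max s1 ler01.
have N0 : 0 <= N := le_trans ler01 N1.
set D := 1 + (xi - N) ^+ 2.
have D1 : 1 <= D by rewrite lerDl sqr_ge0.
have D0 : 0 < D := lt_le_trans ltr01 D1.
suff : japanese s xi <= 3 * N `^ s' * D.
  move=> J; rewrite expr2 mulrA ler_wpM2r ?invr_ge0 ?(ltW D0)//.
by rewrite ler_pdivrMr.
have hs : s / 2 <= s' / 2 by rewrite ler_wpM2r// le_max lexx.
apply: le_trans (ler_powR _ hs) _; first by rewrite lerDl sqr_ge0.
(* A Peetre-type inequality: [xi^2 <= 2 (xi - N)^2 + 2 N^2], and [N >= 1] absorbs the remaining
   constants. *)
apply: (@le_trans _ _ ((3 * (N `^ 2 * D)) `^ (s' / 2))).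
  apply: ge0_ler_powR; rewrite ?nnegrE ?divr_ge0 ?addr_ge0 ?sqr_ge0//.
    by rewrite !mulr_ge0 ?powR_ge0 ?(ltW D0).
  rewrite real_normK ?num_real// powR_mulrn// /D.
  have : 0 <= (xi - N - N) ^+ 2 by exact: sqr_ge0.
  have : 0 <= (N ^+ 2 - 1) * (xi - N) ^+ 2.
    by rewrite mulr_ge0 ?sqr_ge0// subr_ge0 exprn_ege1.
  have : 1 <= N ^+ 2 by rewrite exprn_ege1.
  by nra.
rewrite powRM ?mulr_ge0 ?powR_ge0 ?(ltW D0)// powRM ?powR_ge0 ?(ltW D0)// -powRrM.
rewrite (mulrCA 2) divff ?mulr1 ?pnatr_eq0// -mulrA.
have s21 : s' / 2 <= 1 by lra.
rewrite ler_pM ?mulr_ge0 ?powR_ge0//.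
  by rewrite ler1_powR// ler1n.
by rewrite ler_wpM2l ?powR_ge0// ler1_powR.
Qed.

Lemma measurable_japanese s : measurable_fun setT (japanese s).
Proof.
apply: (measurableT_comp (measurable_powR (s / 2))).
apply: measurable_funD => //; apply: measurable_funX.
exact: normr_measurable.
Qed.

Lemma FL_norm_packet_le (p s N : R) : 2 <= p -> s <= 1 -> 1 <= N ->
  (FL_norm s (p / 2)%:E (packet_hat N) <= (3 * N `^ Num.max s 0 * pi)%:E)%E.
Proof.
move=> p2 s1 N1; apply: (@Lnorm_oneDsqrV_le _ _ _ N).
(* Here [p >= 2] enters: [p / 2] is an admissible exponent, with conjugate in [[1, +oo]]. *)
- by apply: hoelder_conj_ge1; rewrite lee_fin ler_pdivlMr// mul1r.
- by rewrite mulr_ge0 ?powR_ge0.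
- apply: measurable_funM; first exact: measurable_japanese.
  under eq_fun do rewrite cmod_packet_hat.
  apply: measurable_funX; apply: continuous_measurable_fun.
  exact: continuous_oneDsqrV_shift.
- move=> x; rewrite cmod_packet_hat japanese_packet_le// andbT.
  by rewrite mulr_ge0 ?powR_ge0 ?sqr_ge0.
Qed.

Lemma integrable_oneDsqrV_sqr N :
  mu.-integrable setT (fun x => ((1 + (x - N) ^+ 2)^-1 ^+ 2)%:E).
Proof.
apply: (integrable_dominated _ (integrable_oneDsqrV_shift N)).
  apply: measurable_funX; apply: continuous_measurable_fun.
  exact: continuous_oneDsqrV_shift.
move=> x; have /andP[d0 d1] := packet_hat_bounds N x.
by rewrite ger0_norm ?sqr_ge0// expr2 ler_piMl// ltW.
Qed.

(** On [[N, N + 1]] the denominator [1 + (x - N)^2] is at most 2. *)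
Lemma Rintegral_oneDsqrV_sqr_ge N :
  4^-1 <= \int[mu]_x ((1 + (x - N) ^+ 2)^-1 ^+ 2).
Proof.
have mI : measurable (`[N, N + 1] : set R) by exact: measurable_itv.
have iI : mu.-integrable setT (fun x => (4^-1 * \1_(`[N, N + 1]%classic) x)%:E).
  by apply: integrable_scale; exact: integrable_indic_itv.
have <- : \int[mu]_x (4^-1 * \1_(`[N, N + 1]%classic) x) = 4^-1.
  rewrite RintegralZl//; last first.
    exact: integrable_indic_itv.
  rewrite /Rintegral integral_indic// setIT /= lebesgue_measure_itv/= lte_fin.
  by rewrite ltrDl ltr01 -EFinD/= (_ : N + 1 - N = 1) ?mulr1//; ring.
apply: le_Rintegral => //; first exact: integrable_oneDsqrV_sqr.
move=> x _; have /andP[d0 _] := packet_hat_bounds N x.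
rewrite indicE; have [|_] := boolP (x \in _); last by rewrite mulr0 sqr_ge0.
rewrite inE/= in_itv/= mulr1 => /andP[Nx xN].
have D2 : 1 + (x - N) ^+ 2 <= 2.
  have : 0 <= (x - N) * (1 - (x - N)) by rewrite mulr_ge0//; lra.
  by rewrite expr2; lra.
have : 2^-1 <= (1 + (x - N) ^+ 2)^-1.
  by rewrite lef_pV2// posrE -invr_gt0.
by nra.
Qed.

(** Close to the ray [x = 2 t N] and for small [t], the phase is nearly constant where the profile
    lives, so there is little cancellation. *)
Lemma cmod_propagator_packet_ge N t x :
  (Num.sqrt (2 * pi))^-1 * (4^-1 - (`|x - 2 * t * N| + `|t|) * pi) <=
  cmod (propagator (packet_hat N) t x).
Proof.
pose b : R := `|x - 2 * t * N| + `|t|.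
pose theta xi := (x - 2 * t * N) * (xi - N) - t * (xi - N) ^+ 2.
have iD := integrable_oneDsqrV_shift N; have iD2 := integrable_oneDsqrV_sqr N.
have mtheta : measurable_fun setT theta.
  have m1 : measurable_fun setT (fun xi : R => xi - N) by exact: measurable_funB.
  apply: measurable_funB; apply: measurable_funM => //.
  exact: measurable_funX.
have ic : cintegrable (fun xi => cexpi (theta xi) * packet_hat N xi).
  apply: (cintegrable_dominated _ iD2).
    by apply: cmeasurableM; [exact: measurable_cexpi|exact: cmeasurable_packet_hat].
  by move=> xi; rewrite cmodM cmod_cexpi mul1r cmod_packet_hat.
(* Expanding the phase around [xi = N] splits off a unimodular constant and leaves [theta]. *)
have -> : propagator (packet_hat N) t x = ((Num.sqrt (2 * pi))^-1)%:C *
    (cexpi (x * N - t * N ^+ 2) *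
     cintegral (fun xi => cexpi (theta xi) * packet_hat N xi)).
  rewrite -cintegralZ//; congr (_ * cintegral _); apply/funext => xi.
  rewrite mulrA -cexpiD real_normK ?num_real//; congr (cexpi _ * _).
  by rewrite /theta; ring.
rewrite !cmodM cmod_cexpi mul1r cmod_real.
rewrite (@ger0_norm _ (Num.sqrt _)^-1) ?invr_ge0 ?sqrtr_ge0//.
rewrite ler_wpM2l ?invr_ge0 ?sqrtr_ge0//.
apply: le_trans (norm_Re_le_cmod _); apply: le_trans (ler_norm _) => /=.
(* With [|theta| <= b (1 + (xi - N)^2)], the phase error consumes one factor of the squared profile;
   what is left integrates to [b * pi]. *)
apply: (@le_trans _ _ (\int[mu]_xi ((1 + (xi - N) ^+ 2)^-1 ^+ 2 -
    b * (1 + (xi - N) ^+ 2)^-1))).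
  rewrite RintegralB//; last exact: integrable_scale.
  rewrite RintegralZl// {2}/Rintegral integral_oneDsqrV_shift/=.
  by rewrite lerB// Rintegral_oneDsqrV_sqr_ge.
apply: le_Rintegral => //.
- by have := integrableB measurableT iD2 (integrable_scale b iD).
- by case: ic.
move=> xi _; rewrite mulr0 subr0.
have /andP[d0 d1] := packet_hat_bounds N xi.
set u := _^-1 in d0 d1 *.
have uE : u * (1 + (xi - N) ^+ 2) = 1.
  by rewrite mulVf// gt_eqF// ltr_wpDr ?sqr_ge0.
(* Both [|e|] and [e^2] are at most [1 + e^2], for [e = xi - N]. *)
have thb : `|theta xi| <= b * (1 + (xi - N) ^+ 2).
  rewrite /theta /b; move: (x - 2 * t * N) (xi - N) => a e.
  apply: le_trans (ler_normB _ _) _.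
  rewrite (normrM a) (normrM t) normrX (mulrDl `|a|) lerD// ler_wpM2l//.
    have := sqr_ge0 (`|e| - 1); rewrite -(real_normK (num_real e)).
    by have := normr_ge0 e; nra.
  by rewrite real_normK ?num_real// lerDr.
have := cos_ge1B_norm (theta xi) => ct.
have : u ^+ 2 * (1 - `|theta xi|) <= u ^+ 2 * cos (theta xi).
  by rewrite ler_wpM2l ?sqr_ge0.
rewrite [X in _ -> _ <= X]mulrC; apply: le_trans.
rewrite mulrBr mulr1 lerB//.
move: (1 + _) uE thb => D uE thb.
apply: le_trans (ler_wpM2l (sqr_ge0 u) thb) _.
by rewrite expr2 mulrACA uE mulr1 mulrC.
Qed.

End Bounds.

(** * Testing the maximal inequality on the packets *)

Section MaximalFunction.
Context {R : realType}.
Notation mu := (@lebesgue_measure R).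
Implicit Types p s N : R.

Lemma cintegrable_packet_hat N : cintegrable (packet_hat N).
Proof.
apply: (cintegrable_dominated _ (integrable_oneDsqrV_sqr N)).
  exact: cmeasurable_packet_hat.
by move=> xi; rewrite cmod_packet_hat.
Qed.

Lemma in_FL_packet p s N : 2 <= p -> s <= 1 -> 1 <= N ->
  in_FL s (p / 2)%:E (packet_dist N) (packet_hat N).
Proof.
move=> p2 s1 N1; split; first exact: tempered_packet.
  exact: is_fourier_of_packet.
exact: le_lt_trans (FL_norm_packet_le p2 s1 N1) (ltry _).
Qed.

Lemma mixed_norm_packet_ge p N : 0 < p -> 1 <= N ->
  (((Num.sqrt (2 * pi))^-1 / 8 * (N / (32 * pi)) `^ p^-1)%:E <=
   mixed_norm p (fun x t => propagator (packet_hat N) t x))%E.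
Proof.
move=> p0 N1; have N0 : 0 < N := lt_le_trans ltr01 N1.
have pi0 := @pi_gt0 R.
(* Within [d / N] of the passage time, both [|x - 2 t N|] and [|t|] are at most [2 d]. The loss is
   then at most [4 d pi = 1/8], half of the main term [1/4], for every [x] in [[0, N d]]. *)
pose d : R := (32 * pi)^-1.
have d0 : 0 < d by rewrite invr_gt0 mulr_gt0.
have dN0 : 0 < d / N by rewrite divr_gt0.
have dpi : d * pi = 32^-1 by rewrite /d invfM mulfVK// gt_eqF.
have c0 : 0 <= (Num.sqrt (2 * pi))^-1 / 8 :> R.
  by apply: divr_ge0; rewrite // invr_ge0 sqrtr_ge0.
have mI (a b : R) : measurable (`[a, b] : set R) by exact: measurable_itv.
have muI : mu `[0, N * d] = (N * d)%:E.
  by rewrite lebesgue_measure_itv/= lte_fin mulr_gt0// -EFinD subr0.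
rewrite EFinM -poweR_EFin -/d -muI; apply: Lnorm_ge_cst_on => // x.
rewrite /= in_itv/= => /andP[x0 xN].
rewrite gee0_abs ?Lnorm_ge0//.
(* the packet passes through x at time x / (2 N) *)
apply: (@Lnormy_ge_cst_on _ _ `[x / (2 * N) - d / N, x / (2 * N) + d / N]).
- exact: mI.
- rewrite lebesgue_measure_itv/= lte_fin ifT -?EFinD ?lte_fin; lra.
move=> t /=; rewrite in_itv/= => /andP[t1 t2].
rewrite lee_fin ger0_norm ?cmod_ge0//.
apply: le_trans (cmod_propagator_packet_ge N t x).
rewrite ler_wpM2l ?invr_ge0 ?sqrtr_ge0//.
have xE : x = 2 * (x / (2 * N)) * N by field; rewrite gt_eqF.
have dE : d = d / N * N by field; rewrite gt_eqF.
have dN : d / N <= d by rewrite ler_pdivrMr// ler_peMr// ltW.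
have xd : 0 <= x / (2 * N) <= d / 2.
  rewrite divr_ge0 ?mulr_ge0 ?(ltW N0)//= ler_pdivrMr ?mulr_gt0//.
  by rewrite (_ : d / 2 * (2 * N) = N * d)//; field.
have tN : `|x - 2 * t * N| <= 2 * d.
  rewrite {1}xE (_ : 2 * _ * N - _ = 2 * (x / (2 * N) - t) * N); last by ring.
  rewrite {1}dE mulrA normrM (gtr0_norm N0) ler_wpM2r ?(ltW N0)//.
  by rewrite normrM ger0_norm// ler_wpM2l// ler_norml; lra.
have tle : `|t| <= 2 * d by rewrite ler_norml; lra.
suff : (`|x - 2 * t * N| + `|t|) * pi <= 8^-1 by lra.
apply: (@le_trans _ _ (4 * d * pi)); first by rewrite ler_wpM2r ?(ltW pi0)//; lra.
by rewrite -mulrA dpi; lra.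
Qed.

Lemma powR_unbounded (e K : R) : 0 < e -> 0 <= K -> exists2 N, 1 <= N & K < N `^ e.
Proof.
move=> e0 K0; exists ((1 + K) `^ e^-1).
  have K1 : 1 <= 1 + K by rewrite lerDl.
  by rewrite -[leLHS](powRr0 (1 + K)) (ler_powR K1)// invr_ge0 ltW.
by rewrite -powRrM mulVf ?gt_eqF// powRr1 ?addr_ge0// ltrDr ltr01.
Qed.

End MaximalFunction.

Theorem theorem1p4 (R : realType) (p s : R) (hp : 2 <= p) (hs : s < 1 / p) :
  ~ (exists C : R, maximal_function_inequality s p C).
Proof.
move=> [C hC].
have p0 : 0 < p by rewrite (lt_le_trans _ hp).
have pV0 : 0 < p^-1 by rewrite invr_gt0.
have s1 : s <= 1.
  by rewrite (le_trans (ltW hs))// ler_pdivrMr// mul1r (le_trans _ hp)// ler1n.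
have pi0 := @pi_gt0 R.
pose s' := Num.max s 0.
(* Both [s] and 0 lie below [1 / p], so the left side has the strictly larger power of [N]. *)
have e0 : 0 < p^-1 - s'.
  by rewrite subr_gt0 gt_max pV0 andbT -[ltRHS]mul1r.
pose c := (Num.sqrt (2 * pi))^-1 / 8 * (32 * pi)^-1 `^ p^-1 : R.
have c0 : 0 < c.
  by rewrite !mulr_gt0 ?powR_gt0 ?invr_gt0 ?sqrtr_gt0 ?mulr_gt0.
(* The threshold at which [c N^(1/p)] overtakes [3 pi |C| N^s']. *)
have K0 : 0 <= `|C| * (3 * pi) / c.
  by rewrite !mulr_ge0 ?invr_ge0 ?(ltW c0) ?(ltW pi0).
have [N N1] := powR_unbounded e0 K0.
have N0 : 0 < N := lt_le_trans ltr01 N1.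
rewrite ltNge => /negP; apply.
have FLle := FL_norm_packet_le hp s1 N1.
have := hC _ _ (in_FL_packet hp s1 N1) (cintegrable_packet_hat N).
move=> /(le_trans (mixed_norm_packet_ge p0 N1)) main.
have : ((Num.sqrt (2 * pi))^-1 / 8 * (N / (32 * pi)) `^ p^-1 <=
    `|C| * (3 * N `^ s' * pi)).
  rewrite -lee_fin; apply: le_trans main _; rewrite [leRHS]EFinM.
  (* The constant [C] may be negative; passing to its absolute value lets the upper bound on the
     norm be multiplied in. *)
  apply: (@le_trans _ _ (`|C|%:E * FL_norm s (p / 2)%:E (packet_hat N))%E).
    by rewrite lee_wpmul2r ?Lnorm_ge0// lee_fin ler_norm.
  by rewrite lee_wpmul2l// lee_fin.
rewrite powRM ?invr_ge0 ?mulr_ge0 ?(ltW pi0) ?(ltW N0)//.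
(* Splitting off [N^s'] lets it cancel against the right side, leaving the bound on [N^(1/p - s')]
   that the choice of [N] excludes. *)
rewrite -{1}(subrK s' p^-1) powRD; last by rewrite (gt_eqF N0) implybT.
have Ns' : 0 < N `^ s' by rewrite powR_gt0.
by rewrite ler_pdivlMr// => H; rewrite -(ler_pM2r Ns') /c; lra.
Qed.
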